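(* Let $A \in \operatorname{Pd}(2n)$, with distinct symplectic eigenvalues $\mu_1<\cdots<\mu_r$ and associated index sets $\alpha_i,\gamma_i$ ($1\le i\le r$), and let $H\in \operatorname{Sm}(2n)$ be such that $A + H \in \operatorname{Pd}(2n)$. Let $S\in \operatorname{Sp}(2n; A)$ and $\tilde{S} \in \operatorname{Sp}(2n; A+H)$. For each $i=1,\ldots,r$, there exists $N_{[i]} \in \operatorname{Sp}(2|\alpha_i|)$ such that $$\left(S^{-1}\tilde{S}\right)_{\gamma_i \gamma_i} = N_{[i]}+\mathcal{O}(\|H\|^2).$$
   Context: Notation. $\operatorname{Sm}(m)$ is the set of $m\times m$ real symmetric matrices; $\operatorname{Pd}(2n)\subset\operatorname{Sm}(2n)$ is the set of positive definite ones. $\|\cdot\|$ is the spectral norm (maximum singular value). $I_n$ is the $n\times n$ identity matrix and $J_{2n}=\begin{pmatrix}0&I_n\\-I_n&0\end{pmatrix}$. A real $2n\times 2n$ matrix $S$ is symplectic if $S^TJ_{2n}S=J_{2n}$; $\operatorname{Sp}(2n)$ is the group of such matrices. Williamson's theorem: for every $A\in\operatorname{Pd}(2n)$ there is $S\in\operatorname{Sp}(2n)$ with $S^TAS=D\oplus D=\begin{pmatrix}D&0\\0&D\end{pmatrix}$, where $D$ is an $n\times n$ diagonal matrix with positive diagonal entries $d_1(A)\le\cdots\le d_n(A)$ (listed in this order), which do not depend on $S$ and are called the symplectic eigenvalues of $A$. $\operatorname{Sp}(2n;A)$ is the set of all $S\in\operatorname{Sp}(2n)$ with $S^TAS=D\oplus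 D$ for this $D=\operatorname{diag}(d_1(A),\ldots,d_n(A))$. Index sets: if $\mu_1<\cdots<\mu_r$ are the distinct symplectic eigenvalues of $A$, then for $i=1,\ldots,r$, $\alpha_i=\{j\in\{1,\ldots,n\}: d_j(A)=\mu_i\}$, $\beta_i=\{j+n: j\in\alpha_i\}$, $\gamma_i=\alpha_i\cup\beta_i$. For a matrix $M$ and index sets $\mathcal I,\mathcal J$, $M_{\mathcal I\mathcal J}$ is the $|\mathcal I|\times|\mathcal J|$ submatrix of entries $M_{ij}$ with $i\in\mathcal I$, $j\in\mathcal J$ (indices in increasing order). Big-O: $Y=\mathcal O(\|H\|^2)$ means that there exist positive scalars $c$ and $\delta$ such that $\|Y\|\le c\|H\|^2$ for all admissible $H$ (i.e. $H\in \operatorname{Sm}(2n)$ with $A+H\in\operatorname{Pd}(2n)$) with $\|H\|<\delta$. Here $A$ and $S$ are fixed, $H$ varies, $\tilde S$ is an arbitrary element of $\operatorname{Sp}(2n;A+H)$ for each $H$, and $N_{[i]}$ may depend on $H$ and $\tilde S$. *)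

(* Defs.v *)
From mathcomp Require Import all_boot all_order all_algebra.
From mathcomp Require Import all_classical all_reals.

Set Implicit Arguments.
Unset Strict Implicit.
Unset Printing Implicit Defensive.
Import Order.TTheory GRing.Theory Num.Theory.
Local Open Scope ring_scope.

(* Columns are acted on from the left, so the quadratic form is x^T M x. *)
Definition posdefmx (R : realType) (m : nat) (M : 'M[R]_m) : Prop :=
  M \is symmetricmx /\
  forall x : 'cV[R]_m, x != 0 -> 0 < (x^T *m M *m x) 0 0.

Definition singular_value (R : realType) (m n : nat) (M : 'M[R]_(m, n)) (s : R)
    : Prop :=
  0 <= s /\ eigenvalue (M^T *m M) (s ^+ 2).

(* The set of singular values is finite, and it is nonempty when n > 0, so that
   this supremum is a maximum. For n = 0 the set is empty and the norm is 0. *)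
Definition spectral_norm (R : realType) (m n : nat) (M : 'M[R]_(m, n)) : R :=
  sup [set s | singular_value M s]%classic.

Definition Jmx (R : realType) (n : nat) : 'M[R]_(n + n) :=
  block_mx 0 1%:M (- 1%:M) 0.

Definition symplectic (R : realType) (n : nat) (S : 'M[R]_(n + n)) : Prop :=
  S^T *m Jmx R n *m S = Jmx R n.

Definition dsum_diag (R : realType) (n : nat) (d : 'rV[R]_n) : 'M[R]_(n + n) :=
  block_mx (diag_mx d) 0 0 (diag_mx d).

Definition williamson_diag (R : realType) (n : nat) (A : 'M[R]_(n + n))
    (d : 'rV[R]_n) : Prop :=
  [/\ forall j, 0 < d 0 j,
      forall j k : 'I_n, (j <= k)%N -> d 0 j <= d 0 k &
      exists S, symplectic S /\ S^T *m A *m S = dsum_diag d].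

(* By Williamson's theorem, exactly one d satisfies williamson_diag A d when A
   is positive definite; the default value 0 is only reached for other A. *)
Definition sympl_eigvals (R : realType) (n : nat) (A : 'M[R]_(n + n))
    : 'rV[R]_n :=
  xget 0 [set d | williamson_diag A d]%classic.

Definition symplectic_diag (R : realType) (n : nat) (A S : 'M[R]_(n + n))
    : Prop :=
  symplectic S /\ S^T *m A *m S = dsum_diag (sympl_eigvals A).

(* mu lists the distinct symplectic eigenvalues of A in increasing order; this
   determines both r and mu. *)
Definition distinct_sympl_eigvals (R : realType) (n : nat) (A : 'M[R]_(n + n))
    (r : nat) (mu : 'I_r -> R) : Prop :=
  (forall i j : 'I_r, (i < j)%N -> mu i < mu j) /\
  (forall x : R,
     (exists i, mu i = x) <-> (exists j, sympl_eigvals A 0 j = x)).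

Definition alpha_set (R : realType) (n : nat) (A : 'M[R]_(n + n)) (m : R)
    : {set 'I_n} :=
  [set j | sympl_eigvals A 0 j == m]%SET.

Definition beta_set (R : realType) (n : nat) (A : 'M[R]_(n + n)) (m : R)
    : {set 'I_(n + n)} :=
  [set rshift n j | j in alpha_set A m]%SET.

Definition gamma_set (R : realType) (n : nat) (A : 'M[R]_(n + n)) (m : R)
    : {set 'I_(n + n)} :=
  [set lshift n j | j in alpha_set A m]%SET :|: beta_set A m.

Lemma card_gamma_set (R : realType) (n : nat) (A : 'M[R]_(n + n)) (m : R) :
  #|gamma_set A m| = (#|alpha_set A m| + #|alpha_set A m|)%N.
Proof.
rewrite /gamma_set /beta_set cardsU !card_imset; last first.
- exact: lshift_inj.
- exact: rshift_inj.
rewrite (_ : _ :&: _ = finset.set0) ?cards0 ?subn0 //.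
apply/finset.setP => x; rewrite !inE; apply/negP => /andP[].
by move=> /imsetP[j _ ->] /imsetP[k _ /eqP]; rewrite eq_lrshift.
Qed.

(* enum_val enumerates a set of ordinals in increasing order. *)
Definition set_submx (R : realType) (m n : nat) (M : 'M[R]_(m, n))
    (I : {set 'I_m}) (J : {set 'I_n}) : 'M[R]_(#|I|, #|J|) :=
  mxsub (@enum_val _ (mem I)) (@enum_val _ (mem J)) M.

(* The block of rows and columns gamma_set A m, with its size rewritten as
   #|alpha_set A m| + #|alpha_set A m|: the lshift half of gamma_set comes
   first, so the splitting agrees with that of Jmx. *)
Definition gamma_submx (R : realType) (n : nat) (A : 'M[R]_(n + n)) (m : R)
    (M : 'M[R]_(n + n)) : 'M[R]_(#|alpha_set A m| + #|alpha_set A m|) :=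
  castmx (card_gamma_set A m, card_gamma_set A m)
    (set_submx M (gamma_set A m) (gamma_set A m)).

(* Main.v *)
Require Import Defs.
From HB Require Import structures.
From mathcomp Require Import all_boot all_order all_algebra.
From mathcomp Require Import all_classical all_reals.
From mathcomp Require Import topology normedtype sequences interval_inference.
From mathcomp Require Import complex ring lra.

(** Put M = S^-1 S', D the diagonal form of A and B = S^T H S = O(|H|). Then M
    is symplectic and takes D + B to the diagonal form D' of A + H. The proof
    shows that the parts of M linking distinct eigenvalues of A are O(|H|), that
    the diagonal blocks are therefore symplectic up to a quadratic error, and
    that such a matrix is within a quadratic error of a symplectic one.

    Off-diagonal parts. Because M is symplectic, M^T (D + B) M = D' is
    equivalent to the Sylvester equation K M - M K' = - J B M with K = J D and
    K' = J D'. As K^2 = - D^2 and K'^2 = - D'^2, squaring gives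
    M D'^2 - D^2 M = O(|B|), which is solved entry by entry
    ([offdiag_block_bound]). The divisors are differences of squares of an
    eigenvalue of A + H and a distinct one of A; they stay away from 0 once the
    eigenvalues are known to depend continuously on the matrix. Continuity
    follows from monotonicity: if one form dominates another, so do the sorted
    symplectic eigenvalues ([sympl_eigvals_monotone]), and D + B lies between
    (1 - eps) D and (1 + eps) D with eps = O(|B|).

    Diagonal blocks. Let G be the inclusion of the coordinates of one
    eigenvalue, X = G^T M G the block and W the rest of the columns M G. Then
    X^T J X = J - W^T J W with W = O(|H|) ([symplectic_block_defect]).

    Correction. When E = X^T J X - J is small there is P = 1 + O(|E|) with
    P^T (J + E) P = J ([skew_perturbation_normal_form]), so N = X P is
    symplectic and X - N = O(|E|).

    The estimates use the sup norm of the entries; the spectral norm is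
    equivalent to it, by the spectral theorem for the symmetric matrix H. *)

Set Implicit Arguments.
Unset Strict Implicit.
Unset Printing Implicit Defensive.
Import Order.TTheory GRing.Theory Num.Theory.
Import numFieldNormedType.Exports.
Local Open Scope ring_scope.

(** * The entrywise sup norm *)

(** Joins the complete and the normed structure of matrices, which the fixed
    point theorem for contractions asks for together. *)
HB.instance Definition _ (R : realType) (m n : nat) :=
  Complete.on 'M[R]_(m, n).

Lemma eq_ler (R : numDomainType) (x y : R) : x = y -> x <= y.
Proof. by move=> ->. Qed.

Section SupNorm.
Variable R : realType.

Lemma mxnorm_le m n (M : 'M[R]_(m, n)) (c : R) :
  0 <= c -> (forall i j, `|M i j| <= c) -> `|M| <= c.
Proof.
move=> c0 Mc; rewrite /Num.Def.normr /= mx_normrE.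
by apply/bigmax_leP; split => // -[i j] _; exact: Mc.
Qed.

Lemma entry_le_mxnorm m n (M : 'M[R]_(m, n)) i j : `|M i j| <= `|M|.
Proof.
rewrite [leRHS]/Num.Def.normr /= mx_normrE.
by apply/bigmax_geP; right; exists (i, j).
Qed.

(** The constant is any c >= n rather than n, so that one positive constant
    serves all the products in a computation, in dimension zero too. *)
Lemma mxnorm_mul m n p (A : 'M[R]_(m, n)) (B : 'M[R]_(n, p)) (c : R) :
  n%:R <= c -> `|A *m B| <= c * `|A| * `|B|.
Proof.
move=> nc; have c0 : 0 <= c by rewrite (le_trans _ nc).
apply: mxnorm_le => [|i j]; first by rewrite !mulr_ge0.
rewrite mxE (le_trans (ler_norm_sum _ _ _))//.
apply: (@le_trans _ _ (\sum_(k < n) `|A| * `|B|)).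
  by apply: ler_sum => k _; rewrite normrM ler_pM ?entry_le_mxnorm.
by rewrite sumr_const card_ord -[leLHS]mulr_natl -mulrA ler_wpM2r ?mulr_ge0.
Qed.

Lemma mxnorm_tr m n (A : 'M[R]_(m, n)) : `|A^T| = `|A|.
Proof.
have le p q (M : 'M[R]_(p, q)) : `|M^T| <= `|M|.
  by apply: mxnorm_le => // i j; rewrite mxE entry_le_mxnorm.
by apply/eqP; rewrite eq_le le -[X in `|X| <= _]trmxK le.
Qed.

Lemma mxnorm_Jmx k : `|Jmx R k| <= 1.
Proof.
apply: mxnorm_le => // i j; rewrite /Jmx -[ i ]splitK -[ j ]splitK /unsplit.
case: (fintype.split i) => i'; case: (fintype.split j) => j'.
- by rewrite block_mxEul mxE normr0.
- by rewrite block_mxEur mxE; case: eqP; rewrite ?normr1 ?normr0.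
- by rewrite block_mxEdl !mxE normrN; case: eqP; rewrite ?normr1 ?normr0.
- by rewrite block_mxEdr mxE normr0.
Qed.

End SupNorm.

(** * Comparison of the spectral norm with the sup norm *)

Section SpectralNorm.
Variable R : realType.

(** If v M^T M = s^2 v, comparing sup norms of the two sides bounds s^2. *)
Lemma singular_value_le m n (M : 'M[R]_(m, n)) s :
  singular_value M s -> s <= (m + n)%:R * `|M|.
Proof.
move=> [s0 /eigenvalueP[v vM v0]].
have n0 : 0 < `|v| by rewrite normr_gt0.
have c0 : 0 <= (m + n)%:R * `|M| by rewrite mulr_ge0.
rewrite -ler_sqr ?nnegrE//.
rewrite -(ler_pM2r n0).
have -> : s ^+ 2 * `|v| = `|s ^+ 2 *: v|.
  by rewrite mx_normZ ger0_norm ?exprn_ge0.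
rewrite -vM.
have nmn : n%:R <= (m + n)%:R :> R by rewrite ler_nat leq_addl.
have mmn : m%:R <= (m + n)%:R :> R by rewrite ler_nat leq_addr.
rewrite (le_trans (mxnorm_mul _ _ nmn))//.
have := mxnorm_mul M^T M mmn; rewrite mxnorm_tr => h.
have -> : ((m + n)%:R * `|M|) ^+ 2 * `|v| =
  (m + n)%:R * `|v| * ((m + n)%:R * `|M| * `|M|) by ring.
by rewrite ler_wpM2l// mulr_ge0.
Qed.

Lemma spectral_norm_le m n (M : 'M[R]_(m, n)) :
  spectral_norm M <= (m + n)%:R * `|M|.
Proof.
rewrite /spectral_norm; set E := mkset _.
have [->|E0] := eqVneq E set0; first by rewrite sup0 mulr_ge0.
by apply: ge_sup => [|s]; [exact/set0P|exact: singular_value_le].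
Qed.

Lemma singular_value_le_spectral_norm m n (M : 'M[R]_(m, n)) s :
  singular_value M s -> s <= spectral_norm M.
Proof.
move=> Ms; apply: ub_le_sup => //; exists ((m + n)%:R * `|M|).
by move=> t; exact: singular_value_le.
Qed.

Lemma spectral_norm_ge0 m n (M : 'M[R]_(m, n)) : 0 <= spectral_norm M.
Proof.
rewrite /spectral_norm; set E := mkset _.
have [->|/set0P[s Es]] := eqVneq E set0; first by rewrite sup0.
by rewrite (le_trans Es.1)// singular_value_le_spectral_norm.
Qed.

(** Over the complex field a real symmetric matrix is P^-1 D P with P unitary
    and D real; the entries of P are at most 1 in modulus, and those of D are
    singular values up to sign. *)
Lemma mxnorm_le_spectral_norm n (H : 'M[R]_n) :
  H \is symmetricmx -> `|H| <= n%:R * spectral_norm H.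
Proof.
move=> Hsym; set s := spectral_norm H.
have s0 : 0 <= s by exact: spectral_norm_ge0.
pose f : {rmorphism R -> R[i]} := real_complex R.
have HT : H^T = H.
  by have := is_hermitianmxP _ _ _ Hsym; rewrite expr0 scale1r map_mx_id.
pose A := map_mx f H.
have Aherm : A \is hermsymmx.
  apply/is_hermitianmxP; rewrite expr0 scale1r.
  apply/matrixP => i j; rewrite !mxE -[in RHS]HT mxE.
  by rewrite /= -[RHS]/((H i j)%:C^*)%C conjc_real.
have Aeq := orthomx_spectralP (hermitian_normalmx Aherm).
have Dreal := hermitian_spectral_diag_real Aherm.
set P := spectralmx A in Aeq; set D := spectral_diag A in Aeq Dreal.
have Punit : P \in unitmx by exact: spectral_unit.
have Puni : P \is unitarymx by exact: spectral_unitarymx.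
have PA : P *m A = diag_mx D *m P.
  by rewrite [in LHS]Aeq !mulmxA mulmxV// mul1mx.
have Ds k : `|D 0 k| <= s%:C%C.
  have /complex_realP[l Dl] : D 0 k \is Num.real by exact: (mxOverP Dreal).
  rewrite Dl.
  have -> : `|(l%:C)%C| = (`|l|%:C)%C.
    by rewrite normc_def /= expr0n addr0 sqrtr_sqr.
  rewrite lecR; apply: singular_value_le_spectral_norm; split => //.
  rewrite HT real_normK ?num_real// -(eigenvalue_map f) map_mxM -/A.
  apply/eigenvalueP; exists (row k P).
    have kA : row k P *m A = D 0 k *: row k P.
      rewrite -row_mul PA; apply/rowP => j; rewrite !mxE.
      rewrite (bigD1 k)//= big1 ?addr0 ?mxE ?eqxx// => i ik.
      by rewrite mxE eq_sym (negbTE ik) mul0r.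
    (* a real eigenvalue l of H gives the eigenvalue l^2 of H^T H *)
    by rewrite mulmxA kA -scalemxAl kA scalerA Dl rmorphXn /= expr2.
  apply: contraTneq Punit => rk0; apply/negP => Pu.
  have := mulmxV Pu => /(congr1 (row k)); rewrite row_mul rk0 mul0mx.
  by move=> /rowP/(_ k); rewrite !mxE eqxx => /esym/eqP; rewrite oner_eq0.
have Ple i j : `|P i j| <= 1.
  have /unitarymxP/matrixP/(_ i i) := Puni; rewrite !mxE eqxx => sum1.
  have : `|P i j| ^+ 2 <= 1.
    rewrite -[leRHS]sum1 (bigD1 j)//= !mxE -normCK lerDl sumr_ge0// => k _.
    by rewrite !mxE -normCK exprn_ge0.
  by rewrite -[X in _ <= X -> _](expr1n _ 2) ler_sqr ?nnegrE.
apply: mxnorm_le => [|i j]; first by rewrite mulr_ge0.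
rewrite -lecR.
have -> : ((`|H i j|)%:C)%C = `|A i j|.
  by rewrite mxE /= normc_def /= expr0n addr0 sqrtr_sqr.
rewrite Aeq invmx_unitary// -mulmxA mxE (le_trans (ler_norm_sum _ _ _))//.
apply: (@le_trans _ _ (\sum_(k < n) s%:C%C)).
  apply: ler_sum => k _; rewrite normrM !mxE norm_conjC.
  rewrite (bigD1 k)//= big1 ?addr0 => [|l lk]; last first.
    by rewrite mxE eq_sym (negbTE lk) mul0r.
  rewrite mxE eqxx mulr1n normrM -[leRHS]mul1r ler_pM// ?mulr_ge0//.
  by rewrite -[leRHS]mulr1 ler_pM.
by rewrite sumr_const card_ord mulr_natl -[leLHS](rmorphMn f).
Qed.

End SpectralNorm.

(** * Symplectic matrices and quadratic forms *)

Section Symplectic.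
Variable R : realType.

Lemma mul_Jmx_Jmx k : Jmx R k *m Jmx R k = - 1%:M.
Proof.
rewrite /Jmx mulmx_block !mul0mx !mulmx0 !mul1mx !mulmx1 !add0r !addr0.
by rewrite scalar_mx_block opp_block_mx !oppr0.
Qed.

Lemma tr_Jmx k : (Jmx R k)^T = - Jmx R k.
Proof.
by rewrite /Jmx tr_block_mx opp_block_mx !trmx0 linearN /= !trmx1 oppr0 opprK.
Qed.

Definition qform n (A : 'M[R]_n) (x : 'cV[R]_n) : R := (x^T *m A *m x) 0 0.

Lemma symplectic_invmx n (S : 'M[R]_(n + n)) : symplectic S ->
  S \in unitmx /\ invmx S = - (Jmx R n *m S^T *m Jmx R n).
Proof.
move=> hS; have SVS : - (Jmx R n *m S^T *m Jmx R n) *m S = 1%:M.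
  by rewrite mulNmx -!mulmxA (mulmxA S^T) hS mul_Jmx_Jmx opprK.
have Su : S \in unitmx by have [] := mulmx1_unit SVS.
by split=> //; rewrite -[LHS]mul1mx -SVS mulmxK.
Qed.

Lemma symplecticM n (S T : 'M[R]_(n + n)) :
  symplectic S -> symplectic T -> symplectic (S *m T).
Proof.
move=> hS hT; rewrite /symplectic trmx_mul -!mulmxA (mulmxA S^T) (mulmxA _ S).
by rewrite hS (mulmxA T^T) hT.
Qed.

Lemma symplecticV n (S : 'M[R]_(n + n)) : symplectic S -> symplectic (invmx S).
Proof.
move=> hS; have [Su _] := symplectic_invmx hS.
by rewrite /symplectic -{1}hS !mulmxA -trmx_mul mulmxV// trmx1 mul1mx mulmxK.
Qed.

Lemma mul_Jmx_l n p (X : 'M[R]_(n + n, p)) k j :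
  (Jmx R n *m X) (lshift n k) j = X (rshift n k) j.
Proof.
by rewrite -[X]vsubmxK /Jmx mul_block_col mul0mx mul1mx add0r !mxE
  (unsplitK (inl _)) (unsplitK (inr _)).
Qed.

Lemma mul_Jmx_r n p (X : 'M[R]_(n + n, p)) k j :
  (Jmx R n *m X) (rshift n k) j = - X (lshift n k) j.
Proof.
by rewrite -[X]vsubmxK /Jmx mul_block_col !mul0mx mulNmx !mul1mx addr0 col_mxEd
  col_mxEu mxE.
Qed.

Lemma bilin_Jmx n (x y : 'cV[R]_(n + n)) :
  (y^T *m Jmx R n *m x) 0 0 = \sum_(k < n)
    (y (lshift n k) 0 * x (rshift n k) 0 - y (rshift n k) 0 * x (lshift n k) 0).
Proof.
rewrite -mulmxA mxE big_split_ord /= -big_split /=; apply: eq_bigr => k _.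
by rewrite mul_Jmx_l mul_Jmx_r !mxE mulrN.
Qed.

Lemma dsum_diagE n (d : 'rV[R]_n) : dsum_diag d = diag_mx (row_mx d d).
Proof. by rewrite diag_mx_row. Qed.

Lemma qform_dsum_diag n (d : 'rV[R]_n) x : qform (dsum_diag d) x = \sum_(k < n)
    d 0 k * (x (lshift n k) 0 ^+ 2 + x (rshift n k) 0 ^+ 2).
Proof.
rewrite /qform dsum_diagE -mulmxA mul_diag_mx mxE big_split_ord /=.
rewrite -big_split /=.
apply: eq_bigr => k _.
by rewrite !mxE (unsplitK (inl _)) (unsplitK (inr _)); ring.
Qed.

Lemma qform_mul n (A M : 'M[R]_n) x :
  qform (M^T *m A *m M) x = qform A (M *m x).
Proof. by rewrite /qform trmx_mul !mulmxA. Qed.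

(** For the inclusion g of a set of k pairs of conjugate coordinates among n,
    G = sel_mx g makes G^T M G the corresponding principal block of M, and
    G G^T the coordinate projection. *)
Definition sel_mx k n (g : 'I_k -> 'I_n) : 'M[R]_(n + n, k + k) :=
  let G := \matrix_(i < n, j < k) (i == g j)%:R in block_mx G 0 0 G.

Lemma tr_sel_mxl k n (g : 'I_k -> 'I_n) p (X : 'M[R]_(n + n, p)) i j :
  ((sel_mx g)^T *m X) (lshift k i) j = X (lshift n (g i)) j.
Proof.
rewrite mxE big_split_ord /= [X in _ + X]big1 ?addr0 => [|l _]; last first.
  by rewrite mxE block_mxEdl mxE mul0r.
rewrite (bigD1 (g i))//= big1 ?addr0 => [|l lg].
  by rewrite mxE block_mxEul mxE eqxx mul1r.
by rewrite mxE block_mxEul mxE (negbTE lg) mul0r.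
Qed.

Lemma tr_sel_mxr k n (g : 'I_k -> 'I_n) p (X : 'M[R]_(n + n, p)) i j :
  ((sel_mx g)^T *m X) (rshift k i) j = X (rshift n (g i)) j.
Proof.
rewrite mxE big_split_ord /= [X in X + _]big1 ?add0r => [|l _]; last first.
  by rewrite mxE block_mxEur mxE mul0r.
rewrite (bigD1 (g i))//= big1 ?addr0 => [|l lg].
  by rewrite mxE block_mxEdr mxE eqxx mul1r.
by rewrite mxE block_mxEdr mxE (negbTE lg) mul0r.
Qed.

Lemma sel_mxl k n (g : 'I_k -> 'I_n) p (X : 'M[R]_(p, n + n)) i j :
  (X *m sel_mx g) i (lshift k j) = X i (lshift n (g j)).
Proof.
by have := tr_sel_mxl g X^T j i; rewrite -trmx_mul mxE => ->; rewrite mxE.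
Qed.

Lemma sel_mxr k n (g : 'I_k -> 'I_n) p (X : 'M[R]_(p, n + n)) i j :
  (X *m sel_mx g) i (rshift k j) = X i (rshift n (g j)).
Proof.
by have := tr_sel_mxr g X^T j i; rewrite -trmx_mul mxE => ->; rewrite mxE.
Qed.

Lemma Jmx_sel_mx k n (g : 'I_k -> 'I_n) :
  Jmx R n *m sel_mx g = sel_mx g *m Jmx R k.
Proof.
rewrite /Jmx /sel_mx !mulmx_block.
rewrite !(mulmx0, mul0mx, mulmx1, mul1mx, addr0, add0r).
by rewrite mulNmx mulmxN mulmx1 mul1mx.
Qed.

Lemma tr_sel_mxK k n (g : 'I_k -> 'I_n) : injective g ->
  (sel_mx g)^T *m sel_mx g = 1%:M.
Proof.
move=> ginj; rewrite /sel_mx tr_block_mx mulmx_block !trmx0.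
rewrite !(mulmx0, mul0mx, addr0, add0r).
set X := _ *m _; rewrite (_ : X = 1%:M) -?scalar_mx_block//.
apply/matrixP => i j; rewrite !mxE (bigD1 (g i))//= big1 => [|l lg].
  by rewrite !mxE eqxx mul1r addr0 (inj_eq ginj).
by rewrite !mxE (negbTE lg) mul0r.
Qed.

Lemma sel_mx_supp k n (g : 'I_k -> 'I_n) p (X : 'M[R]_(k + k, p)) l j :
  (forall i, l != g i) ->
  (sel_mx g *m X) (lshift n l) j = 0 /\ (sel_mx g *m X) (rshift n l) j = 0.
Proof.
move=> lg; split; rewrite mxE big1// => i _; rewrite -[ i ]splitK /unsplit;
  case: (fintype.split i) => i'.
- by rewrite block_mxEul mxE (negbTE (lg i')) mul0r.
- by rewrite block_mxEur mxE mul0r.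
- by rewrite block_mxEdl mxE mul0r.
- by rewrite block_mxEdr mxE (negbTE (lg i')) mul0r.
Qed.

End Symplectic.

(** * Monotonicity of symplectic eigenvalues *)

Section Monotone.
Variable R : realType.

Lemma mulmx_ker_nontrivial p q (C : 'M[R]_(p, q)) : (p < q)%N ->
  exists2 c : 'cV[R]_q, c != 0 & C *m c = 0.
Proof.
move=> pq; have : kermx C^T != 0.
  rewrite -mxrank_eq0 mxrank_ker -lt0n subn_gt0.
  by rewrite (leq_ltn_trans (rank_leq_col _)).
move=> /rowV0Pn[v /sub_kermxP vC v0]; exists v^T.
  by rewrite -trmx0 (inj_eq (can_inj (@trmxK _ _ _))).
by rewrite -[C]trmxK -trmx_mul vC trmx0.
Qed.

(** A dimension count in the style of Courant and Fischer, written with real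
    pairs (u, v) standing for complex vectors u + i v, on which 2 v^T J u is a
    Hermitian form. On the pairs (w, J w) with w supported on the first j+1
    pairs of coordinates this form is 2 |w|^2, which is at least the energy of
    the pair under d2 divided by d2_j. On the pairs (u, v) with v = - J u on
    the first j pairs of coordinates it is at most the energy under d1 divided
    by d1_j. The first space has dimension 2(j+1) and the second is cut out by
    2j equations, so some w <> 0 has its pair in the image under M of the
    second space, and the two bounds meet there. *)
Lemma sympl_eigvals_monotone n (d1 d2 : 'rV[R]_n) (M : 'M[R]_(n + n)) :
  (forall j, 0 < d1 0 j) ->
  (forall j k : 'I_n, (j <= k)%N -> d1 0 j <= d1 0 k) ->
  (forall j k : 'I_n, (j <= k)%N -> d2 0 j <= d2 0 k) ->
  symplectic M ->
  (forall u, qform (dsum_diag d1) u <= qform (dsum_diag d2) (M *m u)) ->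
  forall j, d1 0 j <= d2 0 j.
Proof.
move=> d1pos d1s d2s hM le12 j.
have [Mu _] := symplectic_invmx hM.
set J := Jmx R n.
pose G1 := sel_mx R (widen_ord (ltn_ord j)).
pose G2 := sel_mx R (widen_ord (ltnW (ltn_ord j))).
have [] := @mulmx_ker_nontrivial _ _
    (G2^T *m ((invmx M *m J + J *m invmx M) *m G1)).
  by rewrite addSn addnS ltnS leqW.
move=> c c0; set w := G1 *m c; rewrite -!mulmxA -/w => Cc.
pose u := invmx M *m w; pose v := invmx M *m (J *m w).
have w0 : w != 0.
  apply: contra_neq c0 => /(congr1 (mulmx G1^T)).
  rewrite /w mulmxA tr_sel_mxK ?mul1mx ?mulmx0//.
  by move=> i k /(congr1 val) /= /val_inj.
have wsupp (k : 'I_n) : (j < k)%N ->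
    w (lshift n k) 0 = 0 /\ w (rshift n k) 0 = 0.
  move=> jk; apply: sel_mx_supp => i; apply/negP => /eqP/(congr1 val)/= ki.
  by have := ltn_ord i; rewrite -ki ltnS leqNgt jk.
have uv (k : 'I_n) : (k < j)%N ->
    v (lshift n k) 0 = - u (rshift n k) 0 /\
    v (rshift n k) 0 = u (lshift n k) 0.
  move=> kj; pose k' := Ordinal kj.
  have kE : widen_ord (ltnW (ltn_ord j)) k' = k by exact/val_inj.
  rewrite mulmxDl -!mulmxA -/u -/v in Cc; split.
    have := congr1 (fun X : 'cV_(j + j) => X (lshift j k') 0) Cc.
    rewrite tr_sel_mxl kE mxE mul_Jmx_l [RHS]mxE => /eqP.
    by rewrite addr_eq0 => /eqP.
  have := congr1 (fun X : 'cV_(j + j) => X (rshift j k') 0) Cc.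
  by rewrite tr_sel_mxr kE mxE mul_Jmx_r [RHS]mxE => /subr0_eq.
pose nrm (x : 'cV[R]_(n + n)) :=
  \sum_(k < n) (x (lshift n k) 0 ^+ 2 + x (rshift n k) 0 ^+ 2).
have nw0 : 0 < nrm w.
  have nn : 0 <= nrm w by apply: sumr_ge0 => k _; rewrite addr_ge0 ?sqr_ge0.
  rewrite lt_neqAle nn andbT eq_sym; apply: contra_neq w0 => /eqP.
  rewrite psumr_eq0 => [/allP nw|k _]; last by rewrite addr_ge0 ?sqr_ge0.
  apply/colP => i; rewrite [RHS]mxE -[ i ]splitK /unsplit.
  case: (fintype.split i) => k;
    have := nw k (mem_index_enum _); rewrite paddr_eq0 ?sqr_ge0//= !sqrf_eq0;
    by case/andP => /eqP ? /eqP ?.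
have vJu : (v^T *m J *m u) 0 0 = nrm w.
  have hMV (x : 'cV[R]_(n + n)) : (invmx M)^T *m (J *m (invmx M *m x)) = J *m x.
    by rewrite !mulmxA (symplecticV hM).
  have -> : v^T *m J *m u = (J *m w)^T *m J *m w.
    by rewrite /v trmx_mul -!mulmxA hMV.
  rewrite bilin_Jmx; apply: eq_bigr => k _.
  by rewrite mul_Jmx_l mul_Jmx_r; ring.
have up : d1 0 j * (2 * nrm w) <=
    qform (dsum_diag d1) u + qform (dsum_diag d1) v.
  rewrite -vJu bilin_Jmx !qform_dsum_diag -big_split !mulr_sumr /=.
  apply: ler_sum => k _.
  have := d1pos j; have := d1pos k.
  set a := u (lshift n k) 0; set b := u (rshift n k) 0.
  set a' := v (lshift n k) 0; set b' := v (rshift n k) 0.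
  (* for k < j, v = - J u makes the k-th term of the form nonpositive *)
  have [kj|jk] := ltnP k j.
    have [ea eb] := uv k kj; rewrite /b' /a' ea eb -/a -/b => pk pj; nra.
  have := d1s _ _ jk => hjk pk pj.
  have h : 2 * (a' * b - b' * a) <= (a ^+ 2 + b ^+ 2) + (a' ^+ 2 + b' ^+ 2).
    by have := sqr_ge0 (a' - b); have := sqr_ge0 (b' + a); nra.
  rewrite -mulrDr (le_trans (ler_wpM2l (ltW pj) h))// ler_wpM2r//.
  by rewrite !addr_ge0 ?sqr_ge0.
have mid : qform (dsum_diag d1) u + qform (dsum_diag d1) v <=
    qform (dsum_diag d2) w + qform (dsum_diag d2) (J *m w).
  by rewrite lerD// (le_trans (le12 _))// /u /v mulKVmx.
have low : qform (dsum_diag d2) w + qform (dsum_diag d2) (J *m w)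
    <= d2 0 j * (2 * nrm w).
  rewrite !qform_dsum_diag -big_split !mulr_sumr /=.
  apply: ler_sum => k _; rewrite mul_Jmx_l mul_Jmx_r.
  have [jk|kj] := ltnP j k.
    by have [-> ->] := wsupp k jk; rewrite oppr0 expr0n /= addr0 !mulr0 addr0.
  have := d2s _ _ kj; set a := w _ _; set b := w _ _ => h.
  have := sqr_ge0 a; have := sqr_ge0 b; nra.
have nw2 : 0 < 2 * nrm w by rewrite mulr_gt0.
by rewrite -(ler_pM2r nw2) (le_trans up)// (le_trans mid).
Qed.

End Monotone.

(** * First-order estimates *)

Section Perturbation.
Variable R : realType.

Lemma fin_pos_lower_bound (I : finType) (f : I -> R) :
  (forall i, 0 < f i) -> exists2 l, 0 < l & forall i, l <= f i.
Proof.
move=> f0; exists (\big[Order.min/1]_i f i); first exact: lt_bigmin.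
by move=> i; exact: bigmin_le.
Qed.

Lemma qform_le n (B : 'M[R]_n) x :
  `|qform B x| <= n%:R * `|B| * \sum_i x i 0 ^+ 2.
Proof.
rewrite /qform -mulmxA mxE (le_trans (ler_norm_sum _ _ _))//.
(* bound each |x_i x_j| by the mean of the two squares *)
apply: (@le_trans _ _ (\sum_(i < n) \sum_(j < n)
    (`|B| / 2 * x i 0 ^+ 2 + `|B| / 2 * x j 0 ^+ 2))).
  apply: ler_sum => i _; rewrite !mxE mulr_sumr.
  rewrite (le_trans (ler_norm_sum _ _ _))//.
  apply: ler_sum => j _; rewrite !normrM -(real_normK (num_real (x i 0)))
    -(real_normK (num_real (x j 0))).
  have := entry_le_mxnorm B i j; set b := `|B i j|; set c := `|B|.
  set u := `|x i 0|; set v := `|x j 0| => bc.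
  have uv0 : 0 <= u * v by exact: mulr_ge0 (normr_ge0 _) (normr_ge0 _).
  have := ler_wpM2r uv0 bc; have : 0 <= c by exact: normr_ge0.
  have := mulr_ge0 (normr_ge0 B) (sqr_ge0 (u - v)); rewrite -/c; nra.
have cE : `|B| = `|B| / 2 + `|B| / 2 by rewrite -splitr.
rewrite [in leRHS]cE; set b := `|B| / 2.
under eq_bigr do rewrite big_split /= sumr_const card_ord -mulr_sumr.
rewrite big_split /= sumrMnl -mulr_sumr sumr_const card_ord.
by set s := \sum_i _; apply: eq_ler; ring.
Qed.

(** Since M^-T = - J M J, congruence by a symplectic matrix is similarity of
    J A and J L. *)
Lemma symplectic_conj_intertwine n (A M L : 'M[R]_(n + n)) :
  symplectic M -> M^T *m A *m M = L ->
  Jmx R n *m A *m M = M *m Jmx R n *m L.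
Proof.
move=> hM <-; have [Mu MV] := symplectic_invmx hM.
have MJM : M *m Jmx R n *m M^T = Jmx R n.
  have := mulmxV Mu; rewrite MV mulmxN !mulmxA => /(congr1 (mulmx^~ (Jmx R n))).
  by rewrite mulNmx mul1mx -!mulmxA mul_Jmx_Jmx !mulmxN mulmx1 opprK.
by rewrite !mulmxA MJM.
Qed.

Lemma Jmx_dsum_diag n (d : 'rV[R]_n) :
  Jmx R n *m dsum_diag d = dsum_diag d *m Jmx R n.
Proof.
rewrite /Jmx /dsum_diag !mulmx_block.
rewrite !(mulmx0, mul0mx, mulmx1, mul1mx, addr0, add0r).
by rewrite mulNmx mulmxN mulmx1 mul1mx.
Qed.

Lemma sqr_Jmx_dsum_diag n (d : 'rV[R]_n) :
  let K := Jmx R n *m dsum_diag d in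
  K *m K = - (dsum_diag d *m dsum_diag d).
Proof.
rewrite /= mulmxA -(mulmxA _ (dsum_diag d)) -Jmx_dsum_diag !mulmxA mul_Jmx_Jmx.
by rewrite !mulNmx mul1mx.
Qed.

(** For K1 = J D and K2 = J D' the squares are diagonal, so that the new
    equation, unlike the given one, is solved entry by entry. *)
Lemma sylvester_square m (K1 K2 M E : 'M[R]_m) :
  K1 *m M - M *m K2 = E ->
  K1 *m K1 *m M - M *m (K2 *m K2) = K1 *m E + E *m K2.
Proof.
by move=> <-; rewrite mulmxBr mulmxBl !mulmxA addrA subrK.
Qed.

(** Relatively to the form of d, the perturbation B is small, so that the form
    of d' lies between those of (1 - eps) d and (1 + eps) d pulled back by M;
    monotonicity is applied to M and to its inverse. *)
Lemma sympl_eigvals_relative_perturbation n (d d' : 'rV[R]_n)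
    (B M : 'M[R]_(n + n)) (eps : R) :
  (forall j, 0 < d 0 j) ->
  (forall j k : 'I_n, (j <= k)%N -> d 0 j <= d 0 k) ->
  (forall j, 0 < d' 0 j) ->
  (forall j k : 'I_n, (j <= k)%N -> d' 0 j <= d' 0 k) ->
  symplectic M -> M^T *m (dsum_diag d + B) *m M = dsum_diag d' ->
  0 <= eps < 1 ->
  (forall x, `|qform B x| <= eps * qform (dsum_diag d) x) ->
  forall j, (1 - eps) * d 0 j <= d' 0 j <= (1 + eps) * d 0 j.
Proof.
move=> dpos ds d'pos d's hM MB /andP[eps0 eps1] Beps j.
have [Mu _] := symplectic_invmx hM.
have qd' u : qform (dsum_diag d') u =
    qform (dsum_diag d) (M *m u) + qform B (M *m u).
  by rewrite -MB qform_mul /qform mulmxDr mulmxDl mxE.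
have qZ t u : qform (dsum_diag (t *: d)) u = t * qform (dsum_diag d) u.
  rewrite !qform_dsum_diag mulr_sumr.
  by apply: eq_bigr => k _; rewrite mxE mulrA.
apply/andP; split.
  have := @sympl_eigvals_monotone R n ((1 - eps) *: d) d' (invmx M).
  move=> /(_ _ _ _ _ _ j); rewrite mxE; apply => //.
  - by move=> k; rewrite mxE mulr_gt0 ?subr_gt0.
  - by move=> k l kl; rewrite !mxE ler_wpM2l ?subr_ge0 ?(ltW eps1) ?ds.
  - exact: symplecticV.
  - move=> u; rewrite qd' mulKVmx// qZ.
    by have := Beps u; rewrite ler_norml => /andP[]; lra.
have := @sympl_eigvals_monotone R n d' ((1 + eps) *: d) M.
move=> /(_ _ _ _ _ _ j); rewrite mxE; apply => //.
- by move=> k l kl; rewrite !mxE ler_wpM2l ?addr_ge0 ?ds.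
- move=> u; rewrite qd' qZ.
  by have := Beps (M *m u); rewrite ler_norml => /andP[]; lra.
Qed.

(** With K = J D and K' = J D', the relation of M to its diagonal form reads
    K M - M K' = - J B M. Squaring, the entry M p q times the difference of the
    squared eigenvalues at q (perturbed) and p (unperturbed) is O(|B|). When the
    unperturbed eigenvalues at p and q differ, that difference stays away from
    0 because the eigenvalues move by O(|B|) only. The bound on M itself comes
    from the quadratic form of D + B being bounded below. *)
Lemma offdiag_block_bound n (d : 'rV[R]_n) :
  (forall j, 0 < d 0 j) ->
  (forall j k : 'I_n, (j <= k)%N -> d 0 j <= d 0 k) ->
  exists c delta : R, [/\ 0 < c, 0 < delta &
    forall (d' : 'rV[R]_n) (B M : 'M[R]_(n + n)),
    (forall j, 0 < d' 0 j) ->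
    (forall j k : 'I_n, (j <= k)%N -> d' 0 j <= d' 0 k) ->
    symplectic M -> M^T *m (dsum_diag d + B) *m M = dsum_diag d' ->
    `|B| <= delta ->
    `|M| <= c /\
    forall p q, row_mx d d 0 p != row_mx d d 0 q -> `|M p q| <= c * `|B|].
Proof.
move=> dpos ds.
pose ld := row_mx d d.
have ldpos p : 0 < ld 0 p.
  by rewrite mxE; case: (fintype.split p) => k.
have [l l0 lld] := fin_pos_lower_bound ldpos.
have [g g0 ggap] : exists2 g, 0 < g &
    forall p q, ld 0 p != ld 0 q -> g <= `|ld 0 p - ld 0 q|.
  pose f (pq : 'I_(n + n) * 'I_(n + n)) :=
    if ld 0 pq.1 == ld 0 pq.2 then 1 else `|ld 0 pq.1 - ld 0 pq.2|.
  have [pq|g g0 gf] := @fin_pos_lower_bound _ f.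
    by rewrite /f; case: eqP => // /eqP pq0; rewrite normr_gt0 subr_eq0.
  by exists g => // p q /negbTE pq; have := gf (p, q); rewrite /f /= pq.
pose L := `|ld| + 1.
have L0 : 0 < L by rewrite ltr_wpDl ?normr_ge0 ?ltr01.
have ldL p : ld 0 p <= L.
  rewrite (le_trans (ler_norm _))//.
  by rewrite (le_trans (entry_le_mxnorm _ _ _))// lerDl.
pose a : R := (n + n).+1%:R.
have a0 : 0 < a by rewrite ltr0n.
have na : (n + n)%:R <= a by rewrite ler_nat.
pose m0 := 4 * L / l + 1.
have m00 : 0 < m0 by rewrite ltr_wpDl// !mulr_ge0 ?invr_ge0 ?ltW.
(* 3 a^4 L m0 |B| bounds the squared equation and g l / 2 is the
   lower bound on the differences of squared eigenvalues *)
pose c1 := 6 * a ^+ 4 * L * m0 / (g * l).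
have c10 : 0 < c1 by rewrite !(mulr_gt0, invr_gt0, exprn_gt0).
(* the two bounds on |B| make eps at most 1/2 and eps L at most g / 2 *)
exists (m0 + c1), (Order.min (l / (2 * a)) (l * g / (2 * a * L))); split.
- exact: addr_gt0.
- by rewrite lt_min !(mulr_gt0, invr_gt0).
move=> d' B M d'pos d's hM MB; rewrite le_min => /andP[B1 B2].
pose b := `|B|; have b0 : 0 <= b by exact: normr_ge0.
pose eps := a * b / l.
have li0 : 0 <= l^-1 by rewrite invr_ge0 ltW.
have eps0 : 0 <= eps by rewrite !mulr_ge0 ?(ltW a0).
have eps2 : eps <= 1 / 2.
  rewrite /eps ler_pdivrMr// mulrC -ler_pdivlMr//.
  by rewrite (le_trans B1)//; apply: eq_ler; field; lra.
have epsL : eps * L <= g / 2.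
  have -> : eps * L = b * (a * L / l) by rewrite /eps; field; lra.
  rewrite -ler_pdivlMr ?(mulr_gt0, invr_gt0)//.
  by rewrite (le_trans B2)//; apply: eq_ler; field; lra.
have qE (e : 'rV[R]_n) x :
    qform (dsum_diag e) x = \sum_i row_mx e e 0 i * x i 0 ^+ 2.
  rewrite qform_dsum_diag big_split_ord /= -big_split; apply: eq_bigr => k _ /=.
  by rewrite row_mxEl row_mxEr mulrDr.
have Beps x : `|qform B x| <= eps * qform (dsum_diag d) x.
  rewrite (le_trans (qform_le _ _))// -/b qE -/ld.
  rewrite (@le_trans _ _ (a * b * \sum_i x i 0 ^+ 2))//.
    by rewrite ler_wpM2r ?sumr_ge0// => [i _|]; rewrite ?sqr_ge0 ?ler_wpM2r.
  have -> : eps = a * b * l^-1 by [].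
  rewrite -[leRHS]mulrA ler_wpM2l ?mulr_ge0 ?(ltW a0)// ler_pdivlMl// mulr_sumr.
  by apply: ler_sum => i _; rewrite ler_wpM2r ?sqr_ge0.
have eps1 : 0 <= eps < 1 by rewrite eps0 /=; lra.
have dd' :=
  sympl_eigvals_relative_perturbation dpos ds d'pos d's hM MB eps1 Beps.
pose ld' := row_mx d' d'.
have ldd' p : (1 - eps) * ld 0 p <= ld' 0 p <= (1 + eps) * ld 0 p.
  by rewrite !mxE; case: (fintype.split p) => k.
have ld'pos p : 0 < ld' 0 p.
  by rewrite mxE; case: (fintype.split p) => k.
have ld'L p : ld' 0 p <= 2 * L.
  have /andP[_ h] := ldd' p; have := ldL p; have := ldpos p; nra.
(* as eps <= 1/2, the form of d' at the q-th basis vector dominates l / 2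
   times the square of each entry of column q of M *)
have Mle : `|M| <= m0.
  apply: mxnorm_le => [|p q]; first exact: ltW.
  pose e : 'cV[R]_(n + n) := delta_mx q 0.
  have h1 : qform (dsum_diag d') e = ld' 0 q.
    rewrite qE -/ld' (bigD1 q)//= big1 => [|i iq].
      by rewrite [e q 0]mxE !eqxx expr1n mulr1 addr0.
    by rewrite [e i 0]mxE (negbTE iq) expr0n mulr0.
  have h2 : qform (dsum_diag d') e =
      qform (dsum_diag d) (M *m e) + qform B (M *m e).
    by rewrite -MB qform_mul /qform mulmxDr mulmxDl mxE.
  have h3 : l * M p q ^+ 2 <= qform (dsum_diag d) (M *m e).
    rewrite qE -/ld (bigD1 p)//= -[leLHS]addr0 lerD//.
      by rewrite -colE [col q M p 0]mxE ler_wpM2r ?sqr_ge0.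
    by apply: sumr_ge0 => i _; rewrite mulr_ge0 ?sqr_ge0 ?(ltW (ldpos _)).
  have := Beps (M *m e); rewrite ler_norml => /andP[h4 _].
  have h5 := ld'L q.
  have h6 : 0 <= qform (dsum_diag d) (M *m e).
    by rewrite (le_trans _ h3)// mulr_ge0 ?sqr_ge0 ?(ltW l0).
  have h7 : M p q ^+ 2 <= 4 * L / l.
    rewrite ler_pdivlMr// mulrC; rewrite -h1 h2 in h5; nra.
  have h8 : M p q ^+ 2 <= m0 ^+ 2.
    rewrite (le_trans h7)// /m0.
    have : 0 <= 4 * L / l by rewrite !mulr_ge0 ?invr_ge0 ?ltW.
    by move: (4 * L / l) => x; nra.
  by rewrite -ler_sqr ?nnegrE ?(ltW m00)// real_normK ?num_real.
split; first by rewrite (le_trans Mle)// lerDl ltW.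
move=> p q pq.
pose K := Jmx R n *m dsum_diag d; pose K' := Jmx R n *m dsum_diag d'.
pose E := K *m M - M *m K'.
have nJ := mxnorm_Jmx R n.
have EJ : E = - (Jmx R n *m B *m M).
  have := symplectic_conj_intertwine hM MB.
  rewrite mulmxDr mulmxDl -(mulmxA M) -/K -/K' /E => <-.
  by rewrite opprD addNKr.
have nE : `|E| <= a ^+ 2 * b * m0.
  rewrite EJ normrN (le_trans (mxnorm_mul _ _ na))//.
  rewrite ler_pM ?mulr_ge0 ?(ltW a0)//.
  rewrite expr2 -mulrA ler_wpM2l ?(ltW a0)//.
  rewrite (le_trans (mxnorm_mul _ _ na))// ler_wpM2r//.
  by rewrite -[leRHS]mulr1 ler_wpM2l// ltW.
have nD (e : 'rV[R]_n) (x : R) : 0 <= x -> (forall p, `|row_mx e e 0 p| <= x) ->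
    `|Jmx R n *m dsum_diag e| <= a * x.
  move=> x0 ex; rewrite (le_trans (mxnorm_mul _ _ na))// ler_pM//.
  - by rewrite mulr_ge0 ?(ltW a0).
  - by rewrite -[leRHS]mulr1 ler_wpM2l// ltW.
  rewrite dsum_diagE; apply: mxnorm_le => // i j; rewrite !mxE.
  case: eqP => [->|_]; rewrite ?mulr1n ?mulr0n ?normr0//.
  by have := ex j; rewrite mxE.
have nK : `|K| <= a * L.
  by apply: nD => [|i]; rewrite ?(ltW L0)// ger0_norm ?(ltW (ldpos _)) ?ldL.
have nK' : `|K'| <= a * (2 * L).
  apply: nD => [|i]; rewrite ?mulr_ge0 ?(ltW L0)//.
  by rewrite ger0_norm ?(ltW (ld'pos _)) ?ld'L.
have key : M p q * (ld' 0 q ^+ 2 - ld 0 p ^+ 2) = (K *m E + E *m K') p q.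
  rewrite -(sylvester_square (erefl E)) !sqr_Jmx_dsum_diag !dsum_diagE.
  rewrite mulNmx mulmxN opprK !mulmx_diag mul_diag_mx mul_mx_diag !mxE -/ld.
  by ring.
have up : `|(K *m E + E *m K') p q| <= 3 * a ^+ 4 * L * m0 * b.
  rewrite (le_trans (entry_le_mxnorm _ _ _))// (le_trans (ler_normD _ _))//.
  have e1 : `|K *m E| <= a * (a * L) * (a ^+ 2 * b * m0).
    rewrite (le_trans (mxnorm_mul _ _ na))//.
    by rewrite ler_pM ?mulr_ge0 ?ler_wpM2l ?(ltW a0).
  have e2 : `|E *m K'| <= a * (a ^+ 2 * b * m0) * (a * (2 * L)).
    rewrite (le_trans (mxnorm_mul _ _ na))//.
    by rewrite ler_pM ?mulr_ge0 ?ler_wpM2l ?(ltW a0).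
  rewrite (le_trans (lerD e1 e2))//; apply: eq_ler; ring.
have low : g * l / 2 <= `|ld' 0 q ^+ 2 - ld 0 p ^+ 2|.
  rewrite subr_sqr normrM -[g * l / 2]mulrAC.
  rewrite ler_pM ?mulr_ge0 ?(ltW g0) ?(ltW l0)//.
    have := ggap _ _ pq; have /andP[] := ldd' q; have := ldL q; have := ldpos q.
    set x := ld 0 p; set y := ld 0 q; set z := ld' 0 q => y0 yL zy1 zy2 xy.
    have yz : `|y - z| <= g / 2 by rewrite ler_norml; apply/andP; split; nra.
    have := ler_distD z x y; rewrite (distrC z y) (distrC z x); lra.
  by rewrite ger0_norm ?addr_ge0 ?(ltW (ldpos _)) ?(ltW (ld'pos _))//
    (le_trans (lld p))// lerDr ltW.
have gl0 : 0 < g * l / 2 by rewrite !mulr_gt0 ?invr_gt0.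
have : `|M p q| <= c1 * b.
  rewrite -(ler_pM2r gl0); rewrite (@le_trans _ _ (3 * a ^+ 4 * L * m0 * b))//.
    by rewrite (le_trans _ up)// -key normrM ler_wpM2l.
  apply: eq_ler; rewrite /c1; field.
  by rewrite !gt_eqF.
by move=> /le_trans; apply; rewrite ler_wpM2r// lerDr ltW.
Qed.

End Perturbation.

(** * Correcting a nearly symplectic matrix *)

Section NearlySymplectic.
Variable R : realType.

(** A skew-symmetric matrix close to J is brought to J by a congruence close to
    the identity. For P = 1 + J Y with Y skew-symmetric, P^T (J + E) P equals
    J + E - 2 Y plus terms of higher order, so the equation is a fixed point
    problem for Y, contracting on the ball of radius |E|. That map preserves
    skew-symmetry, a closed condition, so the fixed point has it too. The
    factor 6 a^4 makes the Lipschitz constant 1/2: of the four terms of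
    T Y1 - T Y2 before halving, two have a norm at most a^2 |E| |Y1 - Y2| and
    two at most 2 a^4 |E| |Y1 - Y2|. *)
Lemma skew_perturbation_normal_form k (E : 'M[R]_(k + k)) :
  E^T = - E -> (6%:R * (k + k).+1%:R ^+ 4) * `|E| <= 1 ->
  exists P : 'M[R]_(k + k),
    P^T *m (Jmx R k + E) *m P = Jmx R k /\ `|P - 1%:M| <= (k + k).+1%:R * `|E|.
Proof.
move=> Eskew Esmall.
set J := Jmx R k; set a : R := (k + k).+1%:R in Esmall *; set e := `|E|.
have a1 : 1 <= a by rewrite /a ler1n.
have ka : (k + k)%:R <= a by rewrite /a ler_nat.
have a0 : 0 <= a by rewrite (le_trans _ a1).
have e0 : 0 <= e by rewrite /e.
have e1 : e <= 1.
  rewrite (le_trans _ Esmall)// ler_peMl// -/e.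
  by have := exprn_ege1 4 a1; lra.
have [K KE] : exists K, K = J + E by exists (J + E).
have JJ : J *m J = - 1%:M by exact: mul_Jmx_Jmx.
have JT : J^T = - J by exact: tr_Jmx.
have nJ : `|J| <= 1 by exact: mxnorm_Jmx.
have nK : `|K| <= 2.
  by rewrite KE (le_trans (ler_normD _ _))// -[2]/(1 + 1) lerD.
have KT : K^T = - K by rewrite KE linearD /= JT Eskew opprD.
have bound (A B C : 'M[R]_(k + k)) (x y z : R) :
    `|A| <= x -> `|B| <= y -> `|C| <= z ->
    `|A *m B *m C| <= a ^+ 2 * (x * y * z).
  move=> Ax By Cz; rewrite (le_trans (mxnorm_mul _ _ ka))//.
  have -> : a ^+ 2 * (x * y * z) = a * (a * x * y) * z by ring.
  rewrite ler_pM ?mulr_ge0// ler_wpM2l//.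
  by rewrite (le_trans (mxnorm_mul _ _ ka))// ler_pM ?mulr_ge0// ler_wpM2l.
pose T (Y : 'M[R]_(k + k)) : 'M[R]_(k + k) := 2^-1 *:
  (E + Y *m J *m E + E *m J *m Y + Y *m (J *m K *m J) *m Y).
pose U := [set Y : 'M[R]_(k + k) | Y^T = - Y /\ `|Y| <= e]%classic.
have nJKJ : `|J *m K *m J| <= a ^+ 2 * 2.
  by have := bound _ _ _ _ _ _ nJ nK nJ; rewrite mul1r mulr1.
have a24 : a ^+ 2 <= a ^+ 4 by rewrite ler_weXn2l.
have a40 : 0 <= a ^+ 4 by rewrite exprn_ge0.
have normhalf (Y : 'M[R]_(k + k)) : `|2^-1 *: Y| = 2^-1 * `|Y|.
  by rewrite mx_normZ ger0_norm ?invr_ge0.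
have TU Y : U Y -> U (T Y).
  move=> [Ysk Ye]; rewrite /U; split.
    rewrite /T [LHS]linearZ /= -scalerN; congr (_ *: _).
    rewrite !linearD /= !trmx_mul JT KT Eskew Ysk !(mulNmx, mulmxN) !opprK.
    by rewrite !mulmxA -!addrA; congr (_ + _); rewrite !addrA; congr (_ + _);
      rewrite addrC.
  rewrite /T normhalf.
  have h1 := bound _ _ _ _ _ _ Ye nJ (lexx `|E|).
  have h2 := bound _ _ _ _ _ _ (lexx `|E|) nJ Ye.
  have h3 := bound _ _ _ _ _ _ Ye nJKJ Ye.
  rewrite -/e in h1 h2 Esmall.
  have := ler_normD (E + Y *m J *m E + E *m J *m Y) (Y *m (J *m K *m J) *m Y).
  have := ler_normD (E + Y *m J *m E) (E *m J *m Y).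
  have := ler_normD E (Y *m J *m E).
  rewrite -/e => n1 n2 n3.
  have ee : 0 <= e * e by exact: mulr_ge0.
  have h4 : a ^+ 2 * (e * e) <= a ^+ 4 * (e * e) by exact: ler_wpM2r.
  have h5 : 6%:R * a ^+ 4 * e * e <= 1 * e by exact: ler_wpM2r.
  have h6 : a ^+ 2 * (e * (a ^+ 2 * 2) * e) = 2 * (a ^+ 4 * (e * e)) by ring.
  move: h1 h2 h3; rewrite h6 !mulr1 => h1 h2 h3.
  have h7 : 6%:R * a ^+ 4 * e * e = 6 * (a ^+ 4 * (e * e)) by ring.
  rewrite h7 in h5; lra.
have Tlip Y1 Y2 : U Y1 -> U Y2 -> `|T Y1 - T Y2| <= 2^-1 * `|Y1 - Y2|.
  move=> [_ Y1e] [_ Y2e].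
  have -> : T Y1 - T Y2 = 2^-1 *: ((Y1 - Y2) *m J *m E + E *m J *m (Y1 - Y2)
      + (Y1 - Y2) *m (J *m K *m J) *m Y1 + Y2 *m (J *m K *m J) *m (Y1 - Y2)).
    rewrite /T -scalerBr; congr (_ *: _).
    rewrite !(mulmxBl, mulmxBr).
    move: (Y1 *m J *m E) (E *m J *m Y1) (Y2 *m J *m E) (E *m J *m Y2).
    move: (Y1 *m (J *m K *m J) *m Y1) (Y2 *m (J *m K *m J) *m Y2).
    move: (Y2 *m (J *m K *m J) *m Y1) => x1 x2 x3 x4 x5 x6 x7.
    apply/matrixP => i j; rewrite !mxE; ring.
  rewrite normhalf ler_wpM2l//.
  set D := Y1 - Y2; set d := `|D|.
  have d0 : 0 <= d by rewrite /d.
  have h1 := bound _ _ _ _ _ _ (lexx `|D|) nJ (lexx `|E|).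
  have h2 := bound _ _ _ _ _ _ (lexx `|E|) nJ (lexx `|D|).
  have h3 := bound _ _ _ _ _ _ (lexx `|D|) nJKJ Y1e.
  have h4 := bound _ _ _ _ _ _ Y2e nJKJ (lexx `|D|).
  rewrite -/e -/d in h1 h2 h3 h4 Esmall.
  have n3 := ler_normD (D *m J *m E + E *m J *m D + D *m (J *m K *m J) *m Y1)
    (Y2 *m (J *m K *m J) *m D).
  have n2 := ler_normD (D *m J *m E + E *m J *m D) (D *m (J *m K *m J) *m Y1).
  have n1 := ler_normD (D *m J *m E) (E *m J *m D).
  have ed : 0 <= e * d by exact: mulr_ge0.
  have h5 : a ^+ 2 * (e * d) <= a ^+ 4 * (e * d) by exact: ler_wpM2r.
  have h6 : 6%:R * a ^+ 4 * e * d <= 1 * d by exact: ler_wpM2r.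
  have e1' : a ^+ 2 * (d * (a ^+ 2 * 2) * e) = 2 * (a ^+ 4 * (e * d)) by ring.
  have e2' : a ^+ 2 * (e * (a ^+ 2 * 2) * d) = 2 * (a ^+ 4 * (e * d)) by ring.
  have e3' : 6%:R * a ^+ 4 * e * d = 6 * (a ^+ 4 * (e * d)) by ring.
  have e4' : a ^+ 2 * (d * 1 * e) = a ^+ 2 * (e * d) by ring.
  rewrite e4' in h1; rewrite mulr1 in h2; rewrite e1' in h3; rewrite e2' in h4.
  rewrite e3' in h6; lra.
have TS : {homo T : Y / U Y >-> U Y} by [].
have Tctr : is_contraction (mkfun_fun TS).
  exists (2^-1)%:nng; split => /=; first by lra.
  by move=> [Y1 Y2] /= [U1 U2]; exact: Tlip.
have Ucl : closed U.
  move=> Y clY.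
  have near eps : 0 < eps -> exists2 Z, U Z & `|Y - Z| < eps.
    by move=> eps0; have [Z [UZ YZ]] := clY _ (nbhsx_ballx Y eps eps0);
      exists Z => //; move: YZ; rewrite -ball_normE.
  split.
    apply/eqP; rewrite -addr_eq0 -normr_eq0 eq_le normr_ge0 andbT.
    apply/ler_addgt0Pr => eps eps0.
    have [|Z [Zsk _] YZ] := near (eps / 2); first by rewrite divr_gt0.
    have -> : Y^T + Y = (Y - Z)^T + (Y - Z).
      by rewrite linearB /= Zsk opprK addrACA subrr addr0.
    by rewrite (le_trans (ler_normD _ _))// mxnorm_tr; lra.
  apply/ler_addgt0Pr => eps eps0.
  have [Z [_ Ze] YZ] := near _ eps0.
  by rewrite -[Y](subrK Z) (le_trans (ler_normD _ _))//; lra.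
have [|Y [Ysk Ye] Yfix] := banach_fixed_point Tctr Ucl.
  by exists 0; split; rewrite ?trmx0 ?oppr0 ?normr0.
exists (1%:M + J *m Y); split; last first.
  rewrite addrC addKr (le_trans (mxnorm_mul _ _ ka))//.
  by rewrite -mulrA ler_wpM2l// -[e]mul1r ler_pM.
have {}Yfix : Y = T Y by [].
have Y2 : Y + Y = E + Y *m J *m E + E *m J *m Y + Y *m (J *m K *m J) *m Y.
  rewrite {1 2}Yfix /T -scalerDl.
  by rewrite (_ : 2^-1 + 2^-1 = 1 :> R) ?scale1r//; lra.
have -> : (1%:M + J *m Y)^T = 1%:M + Y *m J.
  by rewrite linearD /= trmx1 trmx_mul Ysk JT mulNmx mulmxN opprK.
rewrite -KE (_ : _ *m _ *m _ =
  K + Y *m J *m K + K *m J *m Y + Y *m (J *m K *m J) *m Y).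
  have -> : Y *m J *m K = - Y + Y *m J *m E.
    by rewrite KE mulmxDr -(mulmxA Y) JJ mulmxN mulmx1.
  have -> : K *m J *m Y = - Y + E *m J *m Y.
    by rewrite KE !mulmxDl JJ mulNmx mul1mx.
  apply/subr0_eq; rewrite -[RHS](subrr (Y + Y)) {1}Y2 KE.
  apply/matrixP => i j; rewrite !mxE; ring.
rewrite mulmxDl mul1mx mulmxDr mulmx1 mulmxDl !mulmxA.
by rewrite -!addrA; congr (_ + (_ + _)); rewrite addrC addrA.
Qed.

(** X P is symplectic exactly when P brings X^T J X to J. *)
Lemma nearly_symplectic_approx k (X : 'M[R]_(k + k)) :
  let E := X^T *m Jmx R k *m X - Jmx R k in
  let a : R := (k + k).+1%:R in
  6%:R * a ^+ 4 * `|E| <= 1 ->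
  exists2 N, symplectic N & `|X - N| <= a ^+ 2 * `|X| * `|E|.
Proof.
move=> E a Esmall.
have Eskew : E^T = - E.
  rewrite /E linearB /= !trmx_mul trmxK tr_Jmx mulmxA mulmxN mulNmx.
  by rewrite opprB opprK addrC.
have [P [PJP Pa]] := skew_perturbation_normal_form Eskew Esmall.
exists (X *m P).
  have XJ : Jmx R k + E = X^T *m Jmx R k *m X by rewrite /E addrC subrK.
  by rewrite /symplectic trmx_mul -[RHS]PJP XJ !mulmxA.
have -> : X - X *m P = - (X *m (P - 1%:M)) by rewrite mulmxBr mulmx1 opprB.
have ka : (k + k)%:R <= a by rewrite ler_nat.
rewrite normrN (le_trans (mxnorm_mul _ _ ka))//.
have -> : a ^+ 2 * `|X| * `|E| = a * `|X| * (a * `|E|) by ring.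
by rewrite ler_wpM2l ?mulr_ge0.
Qed.

End NearlySymplectic.

(** * The diagonal block of an eigenvalue *)

Section GammaBlock.
Variable R : realType.

Lemma enum_ordD m n : enum 'I_(m + n) =
  [seq lshift n i | i <- enum 'I_m] ++ [seq rshift m i | i <- enum 'I_n].
Proof.
apply: (inj_map val_inj); rewrite val_enum_ord map_cat.
rewrite -(map_comp val (@lshift m n)) -(map_comp val (@rshift m n)) iotaD.
congr (_ ++ _).
  by rewrite -val_enum_ord; apply/eq_map.
rewrite add0n -[X in iota X _]addn0 iotaDl -val_enum_ord.
by rewrite -(map_comp _ val); apply: eq_map.
Qed.

Lemma enum_gamma_set n (A : 'M[R]_(n + n)) m : enum (gamma_set A m) =
  [seq lshift n i | i <- enum (alpha_set A m)] ++
  [seq rshift n i | i <- enum (alpha_set A m)].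
Proof.
have enumE (T : finType) (B : {set T}) : enum B = [seq x <- enum T | x \in B].
  by rewrite {1}/enum_mem -enumT.
rewrite [LHS]enumE enum_ordD filter_cat.
rewrite (filter_map (@lshift n n)) (filter_map (@rshift n n))
  !(enumE _ (alpha_set A m)).
congr (_ ++ _); congr (map _ _); apply: eq_filter => k /=;
  rewrite /gamma_set /beta_set !inE.
  rewrite (mem_imset _ _ (@lshift_inj _ _)) !inE.
  case: imsetP => [[l _ /eqP]|_]; last by rewrite orbF.
  by rewrite eq_lrshift.
rewrite (mem_imset _ _ (@rshift_inj _ _)) !inE.
case: imsetP => [[l _ /eqP]|_] //.
by rewrite eq_rlshift.
Qed.

Lemma gamma_submxE n (A : 'M[R]_(n + n)) m (M : 'M[R]_(n + n)) :
  let G := sel_mx R (@enum_val _ (mem (alpha_set A m))) in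
  gamma_submx A m M = G^T *m M *m G.
Proof.
move=> G.
have sE : size (enum (alpha_set A m)) = #|alpha_set A m| by rewrite cardE.
have El e (i : 'I_#|alpha_set A m|) :
    @enum_val _ (mem (gamma_set A m)) (cast_ord e (lshift _ i)) =
    lshift n (enum_val i).
  rewrite (enum_val_nth (lshift n (enum_val i))) /= enum_gamma_set nth_cat.
  rewrite size_map sE ltn_ord (nth_map (enum_val i)) ?sE//.
  by rewrite -enum_val_nth.
have Er e (i : 'I_#|alpha_set A m|) :
    @enum_val _ (mem (gamma_set A m)) (cast_ord e (rshift #|alpha_set A m| i)) =
    rshift n (enum_val i).
  rewrite (enum_val_nth (lshift n (enum_val i))) /= enum_gamma_set nth_cat.
  rewrite size_map sE /= ltnNge leq_addr /= addKn (nth_map (enum_val i)) ?sE//.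
  by rewrite -enum_val_nth.
apply/matrixP => i j; rewrite /gamma_submx castmxE mxE.
rewrite -[ i ]splitK -[ j ]splitK /unsplit.
case: (fintype.split i) => i'; case: (fintype.split j) => j' /=.
- by rewrite !El sel_mxl tr_sel_mxl.
- by rewrite El Er sel_mxr tr_sel_mxl.
- by rewrite El Er sel_mxl tr_sel_mxr.
- by rewrite !Er sel_mxr tr_sel_mxr.
Qed.

End GammaBlock.

(** * Diagonal blocks of the change of symplectic basis *)

Section Approximation.
Variable R : realType.

(** If A had no Williamson diagonal, its eigenvalue vector would be the default
    0, and S^T A S = 0 contradicts positivity as soon as n > 0. *)
Lemma symplectic_diag_eigvals n (A S : 'M[R]_(n + n)) :
  posdefmx A -> symplectic_diag A S ->
  let d := sympl_eigvals A in
  (forall j, 0 < d 0 j) /\ (forall j k : 'I_n, (j <= k)%N -> d 0 j <= d 0 k).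
Proof.
move=> [_ Apos] [hS SA] d.
have [w|now] := pselect (exists e, williamson_diag A e).
  by have [] : williamson_diag A d
    by exact: (@xgetPex _ 0 [set e | williamson_diag A e]%classic).
suff none : 'I_n -> False by split=> j; case: (none j).
move=> j.
have d0 : d = 0.
  rewrite /d /sympl_eigvals; case: xgetP => // e _ /= we.
  by case: now; exists e.
have [Su _] := symplectic_invmx hS.
pose x := S *m delta_mx (lshift n j) 0 : 'cV[R]_(n + n).
have x0 : x != 0.
  apply/eqP => /(congr1 (mulmx (invmx S))); rewrite mulKmx// mulmx0.
  move=> /matrixP/(_ (lshift n j) 0); rewrite !mxE !eqxx => /eqP.
  by rewrite oner_eq0.
have := Apos _ x0; rewrite -/(qform A x) -qform_mul SA qform_dsum_diag.
by rewrite -/d d0 big1 ?ltxx// => k _; rewrite mxE mul0r.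
Qed.

(** Split the columns M G into the part G X inside the block and the part W
    outside it. The two parts are orthogonal for J, and M G itself is
    symplectic, so the defect of X is quadratic in W. *)
Lemma symplectic_block_defect n k (g : 'I_k -> 'I_n) (M : 'M[R]_(n + n)) :
  injective g -> symplectic M ->
  let G := sel_mx R g in let X := G^T *m M *m G in
  let W := M *m G - G *m X in
  X^T *m Jmx R k *m X - Jmx R k = - (W^T *m Jmx R n *m W).
Proof.
move=> ginj hM G X W.
have GG : G^T *m G = 1%:M by exact: tr_sel_mxK.
have JG : Jmx R n *m G = G *m Jmx R k by exact: Jmx_sel_mx.
have GW : G^T *m W = 0 by rewrite /W mulmxBr !mulmxA GG mul1mx subrr.
have WG : W^T *m G = 0 by rewrite -[LHS]trmxK trmx_mul trmxK GW trmx0.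
have MG : M *m G = G *m X + W by rewrite /W addrC subrK.
have h : (M *m G)^T *m Jmx R n *m (M *m G) = Jmx R k.
  by rewrite trmx_mul -!mulmxA (mulmxA M^T) (mulmxA _ M) hM JG mulmxA GG mul1mx.
clearbody W X; rewrite -[Y in _ - Y]h MG.
have -> : (G *m X + W)^T = X^T *m G^T + W^T by rewrite linearD /= trmx_mul.
rewrite mulmxDl mulmxDr !mulmxDl.
have -> : X^T *m G^T *m Jmx R n *m (G *m X) = X^T *m Jmx R k *m X.
  by rewrite -!mulmxA (mulmxA _ G) JG -!mulmxA (mulmxA _ G) GG mul1mx.
have -> : W^T *m Jmx R n *m (G *m X) = 0.
  by rewrite -!mulmxA (mulmxA _ G) JG -!mulmxA mulmxA WG mul0mx.
have -> : X^T *m G^T *m Jmx R n *m W = 0.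
  have GJ : G^T *m Jmx R n = Jmx R k *m G^T.
    have := congr1 trmx JG.
    by rewrite !trmx_mul !tr_Jmx mulNmx mulmxN => /oppr_inj.
  by rewrite -(mulmxA X^T) GJ -!mulmxA GW !mulmx0.
by rewrite addr0 add0r opprD addNKr.
Qed.

(** Z - G G^T Z keeps exactly the rows of Z that g does not select. *)
Lemma mxnorm_sub_sel_le n k (g : 'I_k -> 'I_n) p
    (Z : 'M[R]_(n + n, p)) (c : R) :
  0 <= c -> injective g ->
  (forall l, (forall i, l != g i) -> forall j,
     `|Z (lshift n l) j| <= c /\ `|Z (rshift n l) j| <= c) ->
  `|Z - sel_mx R g *m ((sel_mx R g)^T *m Z)| <= c.
Proof.
move=> c0 ginj Zc; set G := sel_mx R g.
have GG : G^T *m G = 1%:M by exact: tr_sel_mxK.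
have Gin i j : (G *m (G^T *m Z)) (lshift n (g i)) j = Z (lshift n (g i)) j /\
    (G *m (G^T *m Z)) (rshift n (g i)) j = Z (rshift n (g i)) j.
  split.
    have := tr_sel_mxl g (G *m (G^T *m Z)) i j.
    by rewrite [in LHS]mulmxA GG mul1mx => <-; exact: tr_sel_mxl.
  have := tr_sel_mxr g (G *m (G^T *m Z)) i j.
  by rewrite [in LHS]mulmxA GG mul1mx => <-; exact: tr_sel_mxr.
have dec l : (exists i, l = g i) \/ forall i, l != g i.
  have [/existsP[i /eqP]|/existsPn] := boolP [exists i, l == g i];
    last by right.
  by left; exists i.
apply: mxnorm_le => // r j; rewrite [(Z - _) r j]mxE [X in _ + X]mxE.
rewrite -[ r ]splitK /unsplit.
case: (fintype.split r) => l; have [[i ->]|lg] := dec l.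
- by rewrite (Gin i j).1 subrr normr0.
- by rewrite (sel_mx_supp _ _ lg).1 subr0 (Zc l lg j).1.
- by rewrite (Gin i j).2 subrr normr0.
- by rewrite (sel_mx_supp _ _ lg).2 subr0 (Zc l lg j).2.
Qed.

(** In the basis S the pair (A, A + H) becomes (D, D + B) with B = S^T H S, and
    M = S^-1 S' diagonalizes D + B. The part W of M outside the block is O(|H|)
    by the gap between distinct eigenvalues, so the block is symplectic up to
    O(|H|^2) and a symplectic matrix lies at that distance from it. *)
Lemma gamma_block_near_symplectic n (A S : 'M[R]_(n + n)) (m : R) :
  posdefmx A -> symplectic_diag A S ->
  exists c delta : R, [/\ 0 < c, 0 < delta &
    forall H S', H \is symmetricmx -> posdefmx (A + H) ->
      symplectic_diag (A + H) S' -> spectral_norm H < delta ->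
    exists2 N, symplectic N &
      spectral_norm (gamma_submx A m (invmx S *m S') - N)
        <= c * spectral_norm H ^+ 2].
Proof.
move=> hA hS.
have [dpos dsort] := symplectic_diag_eigvals hA hS.
have [c [dl [c0 dl0 main]]] := offdiag_block_bound dpos dsort.
case: hS => hS SA; have [Su _] := symplectic_invmx hS.
set k := #|alpha_set A m|.
pose a : R := (n + n).+1%:R; pose a' : R := (k + k).+1%:R.
have a0 : 0 < a by rewrite ltr0n.
have a'0 : 0 < a' by rewrite ltr0n.
have na : (n + n)%:R <= a by rewrite ler_nat.
(* bounds: C1 s for |B|, C2 s^2 for the defect of the block, and C3 s <= 1
   is the smallness that the correction step asks for, as s^2 <= s *)
pose C1 := a ^+ 3 * `|S| ^+ 2 + 1.
have C10 : 0 < C1 by rewrite ltr_wpDl ?ltr01 ?mulr_ge0 ?exprn_ge0 ?(ltW a0).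
pose C2 := a ^+ 2 * c ^+ 2 * C1 ^+ 2.
have C20 : 0 < C2 by rewrite !(mulr_gt0, exprn_gt0).
pose C3 := 6%:R * a' ^+ 4 * C2.
have C30 : 0 < C3 by rewrite !(mulr_gt0, exprn_gt0).
exists (2 * a' ^+ 3 * c * C2), (Order.min 1 (Order.min (dl / C1) C3^-1)); split.
- by rewrite !(mulr_gt0, exprn_gt0).
- by rewrite !lt_min ltr01 divr_gt0// invr_gt0.
move=> H S' Hsym hAH hS'; set s := spectral_norm H.
rewrite !lt_min => /andP[s1 /andP[sdl sC3]].
have s0 : 0 <= s by exact: spectral_norm_ge0.
have [d'pos d'sort] := symplectic_diag_eigvals hAH hS'.
case: hS' => hS' SA'.
set M := invmx S *m S'; pose B := S^T *m H *m S.
have hM : symplectic M by exact: symplecticM (symplecticV hS) hS'.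
have MB : M^T *m (dsum_diag (sympl_eigvals A) + B) *m M =
    dsum_diag (sympl_eigvals (A + H)).
  have SM : S' = S *m M by rewrite /M mulKVmx.
  rewrite -SA -SA' /B -mulmxDl -mulmxDr [in RHS]SM (trmx_mul S M).
  by rewrite !mulmxA.
have Hs : `|H| <= a * s.
  by rewrite (le_trans (mxnorm_le_spectral_norm Hsym))// ler_wpM2r.
have Bs : `|B| <= C1 * s.
  rewrite (le_trans (mxnorm_mul _ _ na))//.
  have h1 : `|S^T *m H| <= a * `|S| * (a * s).
    rewrite (le_trans (mxnorm_mul _ _ na))// mxnorm_tr.
    by rewrite ler_wpM2l ?mulr_ge0 ?(ltW a0).
  apply: (@le_trans _ _ (a * (a * `|S| * (a * s)) * `|S|)).
    by rewrite ler_wpM2r// ler_wpM2l// ltW.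
  by rewrite /C1 mulrDl mul1r ler_wpDr//; apply: eq_ler; ring.
have Bdl : `|B| <= dl.
  by rewrite (le_trans Bs)// mulrC -ler_pdivlMr// ltW.
have [Mc Moff] := main _ _ _ d'pos d'sort hM MB Bdl.
pose g := @enum_val _ (mem (alpha_set A m)) : 'I_k -> 'I_n.
have ginj : injective g by exact: enum_val_inj.
rewrite gamma_submxE -/g.
set G := sel_mx R g; set X := G^T *m M *m G.
have Xc : `|X| <= c.
  apply: mxnorm_le => [|p q]; first exact: ltW.
  rewrite /X -[ p ]splitK -[ q ]splitK /unsplit.
  case: (fintype.split p) => i; case: (fintype.split q) => j;
    by rewrite (sel_mxl, sel_mxr) (tr_sel_mxl, tr_sel_mxr)
      (le_trans (entry_le_mxnorm _ _ _)).
pose W := M *m G - G *m X.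
have Wc : `|W| <= c * (C1 * s).
  rewrite /W /X -(mulmxA G^T); apply: mxnorm_sub_sel_le => //.
    by rewrite !mulr_ge0 ?(ltW c0) ?(ltW C10).
  move=> l lg j.
  have lm : sympl_eigvals A 0 l != m.
    apply/negP => /eqP lm; have lA : l \in alpha_set A m by rewrite inE lm.
    by have := lg (enum_rank_in lA l); rewrite /g enum_rankK_in// eqxx.
  have gm i : sympl_eigvals A 0 (g i) = m.
    by have := enum_valP i; rewrite inE => /eqP.
  have cBs : c * `|B| <= c * (C1 * s) by rewrite ler_wpM2l ?(ltW c0).
  rewrite -[ j ]splitK /unsplit.
  by case: (fintype.split j) => i; rewrite ?sel_mxl ?sel_mxr; split;
    rewrite (le_trans (Moff _ _ _)) ?row_mxEl ?row_mxEr ?gm.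
have XE := symplectic_block_defect ginj hM.
rewrite -/G -/X -/W in XE.
have Es : `|X^T *m Jmx R k *m X - Jmx R k| <= C2 * s ^+ 2.
  rewrite XE normrN (le_trans (mxnorm_mul _ _ na))//.
  have h1 : `|W^T *m Jmx R n| <= a * `|W|.
    rewrite (le_trans (mxnorm_mul _ _ na))// mxnorm_tr -[leRHS]mulr1.
    by rewrite ler_wpM2l ?mxnorm_Jmx// mulr_ge0// ltW.
  apply: (@le_trans _ _ (a * (a * (c * (C1 * s))) * (c * (C1 * s)))).
    rewrite ler_pM ?mulr_ge0 ?(ltW a0)// ler_wpM2l ?(ltW a0)//.
    by rewrite (le_trans h1)// ler_wpM2l// ltW.
  by apply: eq_ler; rewrite /C2; ring.
have ss : s ^+ 2 <= s by rewrite expr2 ler_piMl// ltW.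
have [|N hN XN] := nearly_symplectic_approx (X := X).
  rewrite (@le_trans _ _ (6%:R * a' ^+ 4 * (C2 * s ^+ 2)))//.
    by rewrite ler_wpM2l// mulr_ge0// exprn_ge0// ltW.
  rewrite mulrA -/C3 (le_trans (ler_wpM2l (ltW C30) ss))//.
  by rewrite mulrC -ler_pdivlMr// div1r ltW.
exists N => //; rewrite (le_trans (spectral_norm_le _))//.
apply: (@le_trans _ _ (2 * a' * (a' ^+ 2 * c * (C2 * s ^+ 2)))).
  rewrite ler_pM//.
    have -> : 2 * a' = a' + a' by ring.
    by rewrite natrD lerD// ler_nat.
  rewrite (le_trans XN)// ler_pM ?mulr_ge0 ?exprn_ge0 ?(ltW a'0)//.
  by rewrite ler_wpM2l// exprn_ge0// ltW.
by apply: eq_ler; ring.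
Qed.

End Approximation.

Theorem proposition9 (R : realType) (n : nat) (A : 'M[R]_(n + n))
    (r : nat) (mu : 'I_r -> R) (S : 'M[R]_(n + n))
    (hA : posdefmx A)
    (hmu : distinct_sympl_eigvals A mu)
    (hS : symplectic_diag A S)
    (i : 'I_r) :
  exists N : 'M[R]_(n + n) -> 'M[R]_(n + n) ->
             'M[R]_(#|alpha_set A (mu i)| + #|alpha_set A (mu i)|),
    (forall H S' : 'M[R]_(n + n),
       H \is symmetricmx -> posdefmx (A + H) -> symplectic_diag (A + H) S' ->
       symplectic (N H S')) /\
    (exists c delta : R, 0 < c /\ 0 < delta /\
       forall H S' : 'M[R]_(n + n),
         H \is symmetricmx -> posdefmx (A + H) -> symplectic_diag (A + H) S' ->
         spectral_norm H < delta ->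
         spectral_norm (gamma_submx A (mu i) (invmx S *m S') - N H S')
           <= c * spectral_norm H ^+ 2).
Proof.
have [c [delta [c0 delta0 approx]]] := gamma_block_near_symplectic (mu i) hA hS.
pose close (H S' : 'M[R]_(n + n)) :=
  [set N : 'M[R]_(#|alpha_set A (mu i)| + #|alpha_set A (mu i)|) |
  symplectic N /\
  spectral_norm (gamma_submx A (mu i) (invmx S *m S') - N)
    <= c * spectral_norm H ^+ 2]%classic.
(* the default 1 makes N symplectic when H is too large for the estimate *)
exists (fun H S' => xget 1%:M (close H S')); split.
  move=> H S' _ _ _; case: xgetP => [N _ []//|_].
  by rewrite /symplectic trmx1 mul1mx mulmx1.
exists c, delta; split=> //; split=> // H S' Hsym hAH hS' Hd.
have [N hN HN] := approx H S' Hsym hAH hS' Hd.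
by have [] : close H S' (xget 1%:M (close H S')) by apply: xgetPex; exists N.
Qed.
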